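(* Let $b:\mathbb R\to\mathbb R$ be an odd differentiable function with $|b(y)|\lesssim \delta e^{-\sqrt 2|y|}$ and $|b'(y)|\lesssim\delta$ for all $y\in\mathbb R$, where $\delta>0$ is a sufficiently small constant. Then there exists an odd, bounded, time-independent solution $K=K(y)$ of $$\partial_t^2\Phi-\partial_y^2\Phi+b(y)\,\partial_y\Phi=\Phi-\Phi^3,\qquad (t,y)\in\mathbb R\times\mathbb R,$$ that is, an odd bounded $K:\mathbb R\to\mathbb R$ with $-K''+bK'=K-K^3$ on $\mathbb R$. Furthermore, with $H(y)=\tanh(y/\sqrt2)$, the difference $H_\delta:=K-H$ satisfies $$|H_\delta(y)|+|H_\delta'(y)|\lesssim\delta e^{-\sqrt2|y|}\qquad\text{for all }y\in\mathbb R.$$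
   Context: The notation $A\lesssim B$ means $A\le CB$ with a constant $C>0$ independent of $y$ and $\delta$. In the hypothesis on $b$ the implicit constant is fixed in advance; ''sufficiently small'' means $0<\delta<\delta_0$ for some $\delta_0>0$ depending only on this constant, and the implicit constant in the conclusion depends only on it as well. *)

(* Defs.v *)
From Stdlib Require Import Reals.
From Coquelicot Require Import Coquelicot.
Open Scope R_scope.

Definition odd_fun (f : R -> R) : Prop := forall y, f (- y) = - f y.

Definition bounded_fun (f : R -> R) : Prop := exists M, forall y, Rabs (f y) <= M.

(* [ex_derive] of [f] is required separately: [Derive] is total, so
   differentiability of [Derive f] alone does not give that of [f]. *)
Definition twice_differentiable (f : R -> R) : Prop :=
  forall x, ex_derive f x /\ ex_derive (Derive f) x.

(* Classical solutions on R x R, with [Phi t y] the value at time [t] and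
   position [y]. *)
Definition solves_wave (b : R -> R) (Phi : R -> R -> R) : Prop :=
  (forall y, twice_differentiable (fun s => Phi s y)) /\
  (forall t, twice_differentiable (fun x => Phi t x)) /\
  (forall t y,
     Derive_n (fun s => Phi s y) 2 t - Derive_n (fun x => Phi t x) 2 y
       + b y * Derive (fun x => Phi t x) y
     = Phi t y - Phi t y ^ 3).

Definition H (y : R) : R := tanh (y / sqrt 2).

(* Main.v *)
Require Import Defs.
From Stdlib Require Import Reals Lra Psatz.
From Coquelicot Require Import Coquelicot.
Open Scope R_scope.

(** Write r = sqrt 2 and Y = 1 - H^2 = cosh(y/r)^(-2), so that H' = (r/2) Y and
    Y' = - r H Y.  The operator linearised at H kills H', hence Y, and reduction
    of order therefore factors it: putting K = H + Y v and w = Y^2 v', the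
    equation - K'' + b K' = K - K^3 becomes the first-order system

      v' = w / Y^2,
      w' = Y^3 N,
      N = (r/2) beta - r beta H v + beta Y p + 3 H v^2 + Y v^3,

    where beta = b / Y and w = Y^3 p.  The decay hypothesis on b gives
    that beta is bounded by eps, a constant times delta, because Y is comparable
    to exp (- r |y|).  Oddness of K amounts to v being odd, i.e. to p being even
    and v(0) = 0, and decay forces w to vanish at infinity.  Hence v is the
    integral of Y p from 0 and

      p(y) = - Y(y)^(-3) * (integral of Y^3 N from |y| to infinity),

    a fixed point equation for a bounded continuous function p on the line.
    The absolute value makes the right-hand side even by construction; for even
    p the integrand is odd, so that dropping the absolute value changes nothing.

    Two estimates make the right-hand side a contraction by 1/2 of the ball
    |p| <= 2 eps when eps <= 1/100.  The integral of Y is bounded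
    ([abs_amplitude_le]), and the integral of Y^3 from y >= 0 to infinity is at
    most Y(y)^3 ([Y3_primitive_tail]), which cancels the weight Y^(-3)
    ([tail_bound]).  The fixed point has |v| <= r (2 eps) and |p| <= 2 eps, and
    then K - H = Y v and (K - H)' = Y (- r H v + Y p) are both of size eps Y. *)

(** * A fixed point theorem for bounded continuous functions *)
Lemma half_pow_pos (n : nat) : 0 < (/ 2) ^ n.
Proof. apply pow_lt; lra. Qed.

Lemma is_lim_seq_half_pow (A : R) : is_lim_seq (fun n => A * (/ 2) ^ n) 0.
Proof.
  replace (Finite 0) with (Rbar_mult A 0) by (simpl; f_equal; ring).
  apply is_lim_seq_scal_l, is_lim_seq_geom.
  rewrite Rabs_pos_eq; lra.
Qed.

Section FixedPoint.

Variables (M : R) (T : (R -> R) -> R -> R).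

(** The closed ball of radius [M] among the bounded continuous functions. *)
Definition admissible (p : R -> R) : Prop :=
  (forall y, continuous p y) /\ (forall y, Rabs (p y) <= M).

(** The iterates of [T] starting from the zero function. *)
Fixpoint picard (n : nat) : R -> R :=
  match n with O => fun _ => 0 | S m => T (picard m) end.

Hypothesis M_ge0 : 0 <= M.
Hypothesis T_stable : forall p, admissible p -> admissible (T p).
Hypothesis T_contracts : forall p q D, admissible p -> admissible q ->
  (forall y, Rabs (p y - q y) <= D) ->
  forall y, Rabs (T p y - T q y) <= D / 2.

Lemma picard_admissible (n : nat) : admissible (picard n).
Proof.
  induction n as [|n IH]; simpl; [split; intros y|now apply T_stable].
  - apply continuous_const.
  - now rewrite Rabs_R0.
Qed.

Lemma picard_step (n : nat) (y : R) :
  Rabs (picard (S n) y - picard n y) <= M * (/ 2) ^ n.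
Proof.
  revert y; induction n as [|n IH]; intros y.
  - change (picard 0 y) with 0.
    generalize (proj2 (picard_admissible 1) y).
    rewrite Rminus_0_r; simpl; lra.
  - replace (M * (/ 2) ^ S n) with (M * (/ 2) ^ n / 2) by (simpl; field).
    apply (T_contracts (picard (S n)) (picard n));
      auto using picard_admissible.
Qed.

Lemma picard_cauchy (n k : nat) (y : R) :
  Rabs (picard (k + n) y - picard n y) <= 2 * M * (/ 2) ^ n.
Proof.
  apply Rle_trans with (2 * M * ((/ 2) ^ n - (/ 2) ^ (k + n))).
  - induction k as [|k IH].
    + change (0 + n)%nat with n. rewrite !Rminus_diag, Rabs_R0; lra.
    + replace (picard (S k + n) y - picard n y) with
        ((picard (S (k + n)) y - picard (k + n) y)
         + (picard (k + n) y - picard n y)) by (simpl; ring).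
      eapply Rle_trans; [apply Rabs_triang|].
      generalize (picard_step (k + n) y); simpl in *; lra.
  - generalize (half_pow_pos (k + n)); nra.
Qed.

Lemma picard_converges (y : R) : ex_finite_lim_seq (fun n => picard n y).
Proof.
  apply ex_lim_seq_cauchy_corr; intros eps.
  destruct (proj2 (is_lim_seq_spec _ _) (is_lim_seq_half_pow (4 * M)) eps)
    as [N HN].
  exists N; intros n m Hn Hm.
  specialize (HN N (Nat.le_refl N)).
  generalize (picard_cauchy N (n - N) y) (picard_cauchy N (m - N) y).
  rewrite !Nat.sub_add by assumption.
  rewrite Rminus_0_r in HN; apply Rabs_def2 in HN.
  intros H1 H2.
  apply Rabs_le_between in H1; apply Rabs_le_between in H2.
  apply Rabs_def1; lra.
Qed.

(** The pointwise limit of the iterates; by [picard_limit_dist] the convergence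
    is uniform. *)
Definition picard_limit (y : R) : R := real (Lim_seq (fun n => picard n y)).

Lemma picard_limit_correct (y : R) :
  is_lim_seq (fun n => picard n y) (picard_limit y).
Proof. apply Lim_seq_correct', picard_converges. Qed.

Lemma picard_limit_dist (n : nat) (y : R) :
  Rabs (picard_limit y - picard n y) <= 2 * M * (/ 2) ^ n.
Proof.
  apply Rabs_le_between.
  assert (Hl : is_lim_seq (fun k => picard (k + n) y) (picard_limit y))
    by (apply (is_lim_seq_incr_n (fun k => picard k y)), picard_limit_correct).
  assert (Hb : forall k, picard n y - 2 * M * (/ 2) ^ n <= picard (k + n) y
                 <= picard n y + 2 * M * (/ 2) ^ n).
  { intros k; generalize (picard_cauchy n k y); rewrite Rabs_le_between; lra. }
  generalize (is_lim_seq_le _ _ _ _ (fun k => proj1 (Hb k))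
                (is_lim_seq_const _) Hl)
             (is_lim_seq_le _ _ _ _ (fun k => proj2 (Hb k))
                Hl (is_lim_seq_const _)).
  simpl; lra.
Qed.

Lemma picard_limit_admissible : admissible picard_limit.
Proof.
  split; intros y.
  - apply continuity_pt_filterlim.
    assert (Hy : Boule y (mkposreal 1 Rlt_0_1) y)
      by (unfold Boule; rewrite Rminus_diag, Rabs_R0; simpl; lra).
    apply (CVU_continuity picard picard_limit y (mkposreal 1 Rlt_0_1)); auto.
    + intros eps Heps.
      destruct (proj2 (is_lim_seq_spec _ _) (is_lim_seq_half_pow (2 * M))
                  (mkposreal eps Heps)) as [N HN].
      exists N; intros n z Hn _.
      specialize (HN n Hn); simpl in HN.
      rewrite Rminus_0_r in HN; apply Rabs_def2 in HN.
      eapply Rle_lt_trans; [apply picard_limit_dist|tauto].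
    + intros n z _; apply continuity_pt_filterlim, picard_admissible.
  - assert (Hb := fun n => proj1 (Rabs_le_between _ _) (proj2 (picard_admissible n) y)).
    apply Rabs_le_between.
    generalize (is_lim_seq_le _ _ _ _ (fun k => proj1 (Hb k))
                  (is_lim_seq_const _) (picard_limit_correct y))
               (is_lim_seq_le _ _ _ _ (fun k => proj2 (Hb k))
                  (picard_limit_correct y) (is_lim_seq_const _)).
    simpl; lra.
Qed.

Lemma picard_limit_fixed (y : R) : T picard_limit y = picard_limit y.
Proof.
  apply Rminus_diag_uniq.
  cut (Rabs (T picard_limit y - picard_limit y) <= 0).
  { intros H0; apply Rabs_le_between in H0; lra. }
  apply (is_lim_seq_le (fun _ => Rabs (T picard_limit y - picard_limit y))
           (fun n => 2 * M * (/ 2) ^ n)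
           (Rabs (T picard_limit y - picard_limit y)) 0);
    [|apply is_lim_seq_const|apply is_lim_seq_half_pow].
  intros n.
  assert (H1 := T_contracts _ _ _ picard_limit_admissible
                  (picard_admissible n) (picard_limit_dist n) y).
  assert (H2 := picard_limit_dist (S n) y); simpl in H2.
  apply Rabs_le_between in H1; apply Rabs_le_between in H2.
  apply Rabs_le_between; lra.
Qed.

(** A map of the ball of radius [M] to itself that halves uniform distances has a
    fixed point.  Distances are given by bounds [D], which avoids suprema. *)
Lemma contraction_fixed_point :
  exists p, admissible p /\ forall y, T p y = p y.
Proof.
  exists picard_limit; split;
    [exact picard_limit_admissible|exact picard_limit_fixed].
Qed.

End FixedPoint.

(** * The kink and the derivative of its profile *)

(** [Y y] is the square of the hyperbolic secant of [y / sqrt 2]; up to the factor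
    [sqrt 2 / 2] it is the derivative of [H] (see [is_derive_H]), and it spans the
    decaying solutions of the linearised equation. *)
Definition Y (y : R) : R := 1 - H y ^ 2.

Lemma sqrt2_sqr : sqrt 2 * sqrt 2 = 2.
Proof. apply sqrt_sqrt; lra. Qed.

Lemma sqrt2_bounds : 1 < sqrt 2 < 3 / 2.
Proof.
  generalize sqrt2_sqr (sqrt_pos 2); split; nra.
Qed.

Lemma div_sqrt2 (x : R) : x / sqrt 2 = sqrt 2 / 2 * x.
Proof.
  generalize sqrt2_sqr sqrt2_bounds; intros H2 Hb.
  apply Rmult_eq_reg_r with (sqrt 2); [|lra].
  transitivity (sqrt 2 * sqrt 2 / 2 * x); [rewrite H2|]; field; lra.
Qed.

Lemma cosh_pos (x : R) : 0 < cosh x.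
Proof. unfold cosh; generalize (exp_pos x) (exp_pos (- x)); lra. Qed.

Lemma cosh_sqr_minus_sinh_sqr (x : R) : cosh x ^ 2 - sinh x ^ 2 = 1.
Proof.
  unfold cosh, sinh.
  transitivity (exp x * exp (- x)); [field|].
  rewrite <- exp_plus, Rplus_opp_r; apply exp_0.
Qed.

Lemma Y_cosh (y : R) : Y y = / cosh (y / sqrt 2) ^ 2.
Proof.
  unfold Y, H, tanh.
  generalize (cosh_pos (y / sqrt 2)) (cosh_sqr_minus_sinh_sqr (y / sqrt 2)).
  set (x := y / sqrt 2); intros Hc Hcs.
  transitivity ((cosh x ^ 2 - sinh x ^ 2) / cosh x ^ 2);
    [field|rewrite Hcs; field]; lra.
Qed.

Lemma Y_pos (y : R) : 0 < Y y.
Proof.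
  rewrite Y_cosh; apply Rinv_0_lt_compat, pow_lt, cosh_pos.
Qed.

Lemma Y_le_1 (y : R) : Y y <= 1.
Proof. unfold Y; generalize (pow2_ge_0 (H y)); lra. Qed.

Lemma H_bounds (y : R) : -1 < H y < 1.
Proof. generalize (Y_pos y); unfold Y; split; nra. Qed.

Lemma sinh_opp (x : R) : sinh (- x) = - sinh x.
Proof. unfold sinh; rewrite Ropp_involutive; field. Qed.

Lemma cosh_opp (x : R) : cosh (- x) = cosh x.
Proof. unfold cosh; rewrite Ropp_involutive; field. Qed.

Lemma H_odd : odd_fun H.
Proof.
  intros y; unfold H, tanh.
  replace (- y / sqrt 2) with (- (y / sqrt 2)) by (unfold Rdiv; ring).
  rewrite sinh_opp, cosh_opp; unfold Rdiv; ring.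
Qed.

Lemma Y_even (y : R) : Y (- y) = Y y.
Proof. unfold Y; rewrite H_odd; ring. Qed.

Lemma Y_abs (y : R) : Y (Rabs y) = Y y.
Proof. unfold Rabs; destruct (Rcase_abs y); auto using Y_even. Qed.

Lemma H_ge0 (y : R) : 0 <= y -> 0 <= H y.
Proof.
  intros Hy; unfold H, tanh.
  assert (Hx : - (y / sqrt 2) <= y / sqrt 2).
  { rewrite div_sqrt2; generalize sqrt2_bounds; intros Hb.
    generalize (Rmult_le_pos (sqrt 2 / 2) y ltac:(lra) Hy); lra. }
  apply Rmult_le_pos; [|left; apply Rinv_0_lt_compat, cosh_pos].
  assert (He : exp (- (y / sqrt 2)) <= exp (y / sqrt 2)).
  { destruct Hx as [Hx|Hx]; [left; now apply exp_increasing|right; now f_equal]. }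
  unfold sinh; lra.
Qed.

Lemma Y_exp_bounds (y : R) :
  exp (- sqrt 2 * Rabs y) <= Y y <= 4 * exp (- sqrt 2 * Rabs y).
Proof.
  rewrite <- Y_abs, Y_cosh, div_sqrt2.
  generalize (Rabs_pos y); set (a := Rabs y); intros Ha.
  set (x := sqrt 2 / 2 * a).
  assert (Hx : 0 <= x) by (apply Rmult_le_pos; [generalize sqrt2_bounds|]; lra).
  replace (- sqrt 2 * a) with (- x + - x) by (unfold x; field).
  rewrite exp_plus, exp_Ropp.
  assert (H1 : 1 <= exp x) by (generalize (exp_ineq1_le x); lra).
  assert (Hc : exp x / 2 <= cosh x <= exp x).
  { unfold cosh; rewrite exp_Ropp.
    assert (Hi : / exp x <= 1) by (rewrite <- Rinv_1; apply Rinv_le_contravar; lra).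
    assert (0 < / exp x) by (apply Rinv_0_lt_compat; lra).
    lra. }
  replace (4 * (/ exp x * / exp x)) with (/ (exp x / 2) ^ 2) by (field; lra).
  replace (/ exp x * / exp x) with (/ exp x ^ 2) by (field; lra).
  split; apply Rinv_le_contravar; try apply pow_incr; try apply pow_lt; lra.
Qed.

Lemma is_derive_H (y : R) : is_derive H y (sqrt 2 / 2 * Y y).
Proof.
  apply is_derive_ext with (fun z => sinh (sqrt 2 / 2 * z) / cosh (sqrt 2 / 2 * z)).
  { intros z; unfold H, tanh; now rewrite div_sqrt2. }
  rewrite Y_cosh, div_sqrt2.
  generalize (cosh_sqr_minus_sinh_sqr (sqrt 2 / 2 * y)) (cosh_pos (sqrt 2 / 2 * y)).
  intros Hcs Hc.
  assert (Hlin : is_derive (fun z => sqrt 2 / 2 * z) y (sqrt 2 / 2))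
    by (auto_derive; [easy|ring]).
  assert (Hs := is_derive_comp sinh _ _ _ _
    (proj2 (is_derive_Reals _ _ _) (derivable_pt_lim_sinh (sqrt 2 / 2 * y))) Hlin).
  assert (Hch := is_derive_comp cosh _ _ _ _
    (proj2 (is_derive_Reals _ _ _) (derivable_pt_lim_cosh (sqrt 2 / 2 * y))) Hlin).
  assert (Hd := is_derive_div _ _ _ _ _ Hs Hch (Rgt_not_eq _ _ Hc)).
  eapply eq_ind; [exact Hd|].
  unfold scal; simpl; unfold mult; simpl.
  transitivity (sqrt 2 / 2 * (cosh (sqrt 2 / 2 * y) ^ 2 - sinh (sqrt 2 / 2 * y) ^ 2)
     / cosh (sqrt 2 / 2 * y) ^ 2); [field|rewrite Hcs; field]; lra.
Qed.

Lemma Derive_H (y : R) : Derive (fun x : R => H x) y = sqrt 2 / 2 * Y y.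
Proof. apply is_derive_unique, is_derive_H. Qed.

Lemma is_derive_Y (y : R) : is_derive Y y (- sqrt 2 * H y * Y y).
Proof.
  unfold Y; auto_derive; [exists (sqrt 2 / 2 * Y y); apply is_derive_H|].
  rewrite Derive_H; unfold Y; field.
Qed.

Lemma continuous_H (y : R) : continuous H y.
Proof. apply (ex_derive_continuous H); eexists; apply is_derive_H. Qed.

Lemma continuous_Y (y : R) : continuous Y y.
Proof. apply (ex_derive_continuous Y); eexists; apply is_derive_Y. Qed.

(** * Integrals over a neighbourhood of infinity *)
Lemma ex_RInt_cont (f : R -> R) (a b : R) :
  (forall y, continuous f y) -> ex_RInt f a b.
Proof. intros Hf; apply (ex_RInt_continuous f); auto. Qed.

Lemma abs_RInt_le_primitive (f G g : R -> R) (a b : R) :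
  (forall y, continuous f y) -> (forall y, continuous g y) ->
  (forall y, is_derive G y (g y)) ->
  a <= b -> (forall y, a <= y <= b -> Rabs (f y) <= g y) ->
  Rabs (RInt f a b) <= G b - G a.
Proof.
  intros Hf Hg HG Hab Hle.
  apply (norm_RInt_le f g a b (RInt f a b) (minus (G b) (G a))); auto.
  - apply (RInt_correct f), ex_RInt_cont, Hf.
  - apply (is_RInt_derive G g); auto.
Qed.

Lemma RInt_reflect (f : R -> R) (a b : R) :
  (forall y, continuous f y) ->
  RInt f (- a) (- b) = - RInt (fun y => f (- y)) a b.
Proof.
  intros Hf.
  assert (Hi := is_RInt_comp_opp f a b _ (RInt_correct f (- a) (- b)
                  (ex_RInt_cont f _ _ Hf))).
  assert (Ho := is_RInt_opp _ _ _ _ Hi).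
  assert (He : RInt (fun y => f (- y)) a b = - RInt f (- a) (- b)).
  { apply is_RInt_unique.
    eapply is_RInt_ext; [|exact Ho].
    intros x _; apply (Ropp_involutive (f (- x))). }
  now rewrite He, Ropp_involutive.
Qed.

(** The integral of [f] from [y] to infinity, as the limit of the integrals up to
    the integers.  It is meaningful when that limit is finite, which
    [tail_correct] provides under a bound by a multiple of [Y ^ 3]. *)
Definition tail (f : R -> R) (y : R) : R :=
  real (Lim_seq (fun n => RInt f y (INR n))).

(** A primitive of [Y ^ 3], found by taking [H] as the variable: as H' = (r/2) Y,
    the integrand becomes r (1 - H^2)^2. *)
Definition Y3_primitive (y : R) : R :=
  sqrt 2 * (H y - 2 / 3 * H y ^ 3 + / 5 * H y ^ 5).

Lemma is_derive_Y3_primitive (y : R) : is_derive Y3_primitive y (Y y ^ 3).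
Proof.
  assert (Hd : ex_derive (fun x => H x) y) by (eexists; apply is_derive_H).
  unfold Y3_primitive; auto_derive; [auto|].
  rewrite Derive_H.
  transitivity (sqrt 2 * sqrt 2 / 2 * (Y y * (1 - H y ^ 2) ^ 2));
    [|rewrite sqrt2_sqr; unfold Y]; field.
Qed.

(** In terms of h = H(y), the limit of the primitive at infinity exceeds its value
    at y by r (1 - h)^3 (8 + 9 h + 3 h^2) / 15, while Y^3 = (1 - h)^3 (1 + h)^3. *)
Lemma Y3_primitive_tail (x y : R) :
  0 <= y -> Y3_primitive x - Y3_primitive y <= Y y ^ 3.
Proof.
  intros Hy; unfold Y3_primitive, Y.
  generalize (H_bounds x) (H_bounds y) (H_ge0 y Hy) sqrt2_bounds.
  generalize (H x) (H y) (sqrt 2); intros k h r Hk Hh Hh0 Hr.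
  (* The difference of the two sides is (1 - k)^3 (8 + 9 k + 3 k^2) / 15. *)
  assert (H1 : k - 2 / 3 * k ^ 3 + / 5 * k ^ 5 <= 8 / 15).
  { assert (0 <= (1 - k) ^ 3) by (apply pow_le; lra).
    assert (0 <= 8 + 9 * k + 3 * k ^ 2) by nra.
    nra. }
  assert (H2 : 0 <= (1 - h) ^ 3) by (apply pow_le; lra).
  assert (H3 : r * (8 + 9 * h + 3 * h ^ 2) <= 15 * (1 + h) ^ 3) by nra.
  apply Rle_trans with (r * ((1 - h) ^ 3 * (8 + 9 * h + 3 * h ^ 2) / 15)); nra.
Qed.

Lemma continuous_pow_comp (f : R -> R) (n : nat) (y : R) :
  continuous f y -> continuous (fun z => f z ^ n) y.
Proof.
  intros Hf; induction n as [|n IH]; simpl.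
  - apply continuous_const.
  - now apply (continuous_mult f (fun z => f z ^ n)).
Qed.

(** Continuous functions bounded by [B * Y ^ 3], a class of functions integrable at
    infinity. *)
Definition Y3_bounded (B : R) (f : R -> R) : Prop :=
  (forall y, continuous f y) /\ (forall y, Rabs (f y) <= B * Y y ^ 3).

Lemma abs_RInt_Y3_bounded (B : R) (f : R -> R) (a b : R) :
  Y3_bounded B f -> a <= b ->
  Rabs (RInt f a b) <= B * (Y3_primitive b - Y3_primitive a).
Proof.
  intros [Hf HB] Hab; rewrite Rmult_minus_distr_l.
  apply (abs_RInt_le_primitive f (fun y => B * Y3_primitive y)
           (fun y => B * Y y ^ 3)); auto; intros y.
  - apply (continuous_mult (fun _ => B) (fun z => Y z ^ 3));
      [apply continuous_const|apply continuous_pow_comp, continuous_Y].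
  - apply (is_derive_scal Y3_primitive y B (Y y ^ 3)), is_derive_Y3_primitive.
Qed.

Lemma Y3_bounded_ge0 (B : R) (f : R -> R) : Y3_bounded B f -> 0 <= B.
Proof.
  intros [_ HB]; generalize (HB 0) (Rabs_pos (f 0)) (pow_lt _ 3 (Y_pos 0)); nra.
Qed.

Lemma RInt_split_at (f : R -> R) (a b c : R) :
  (forall y, continuous f y) -> RInt f a c = RInt f a b + RInt f b c.
Proof.
  intros Hf; symmetry; apply (RInt_Chasles f); now apply ex_RInt_cont.
Qed.

Lemma tail_0_correct (B : R) (f : R -> R) :
  Y3_bounded B f ->
  is_lim_seq (fun n => RInt f 0 (INR n)) (tail f 0).
Proof.
  intros Hf; assert (HB := Y3_bounded_ge0 _ _ Hf).
  apply Lim_seq_correct'.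
  assert (Hn : forall n, Rabs (RInt f (INR n) (INR (S n))) <=
      B * (Y3_primitive (INR (S n)) - Y3_primitive (INR n))).
  { intros n; apply abs_RInt_Y3_bounded; auto; rewrite S_INR; lra. }
  assert (H0 : forall n, Y3_primitive (INR n) - Y3_primitive 0 <= 1).
  { intros n; eapply Rle_trans; [apply Y3_primitive_tail; lra|].
    generalize (Y_pos 0) (Y_le_1 0); intros; rewrite <- (pow1 3).
    apply pow_incr; lra. }
  assert (Hmon : forall n, Y3_primitive (INR n) <= Y3_primitive (INR (S n))).
  { intros n.
    assert (HY : Y3_bounded 1 (fun y => Y y ^ 3)).
    { split; intros y; [apply continuous_pow_comp, continuous_Y|].
      rewrite Rabs_pos_eq; [lra|left; apply pow_lt, Y_pos]. }
    assert (Hle : INR n <= INR (S n)) by (rewrite S_INR; lra).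
    generalize (abs_RInt_Y3_bounded 1 _ _ _ HY Hle)
      (Rabs_pos (RInt (fun y => Y y ^ 3) (INR n) (INR (S n)))); lra. }
  (* Adding the increasing bounded sequence [u] to the integrals makes them
     increasing and bounded as well, so they are the difference of two convergent
     sequences. *)
  set (u := fun n => B * (Y3_primitive (INR n) - Y3_primitive 0)).
  assert (Hu : ex_finite_lim_seq u).
  { apply (ex_finite_lim_seq_incr u B); intros n; unfold u.
    - generalize (Hmon n); nra.
    - generalize (H0 n); nra. }
  assert (Hv : ex_finite_lim_seq (fun n => RInt f 0 (INR n) + u n)).
  { apply (ex_finite_lim_seq_incr _ (2 * B)); intros n; unfold u.
    - rewrite (RInt_split_at f 0 (INR n) (INR (S n))) by apply Hf.
      generalize (Hn n); rewrite Rabs_le_between; lra.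
    - generalize (abs_RInt_Y3_bounded B f 0 (INR n) Hf (pos_INR n)) (H0 n).
      rewrite Rabs_le_between; nra. }
  destruct Hu as [lu Hu]; destruct Hv as [lv Hv]; exists (lv - lu).
  apply is_lim_seq_ext with (fun n => RInt f 0 (INR n) + u n - u n);
    [intros n; ring|].
  now apply is_lim_seq_minus'.
Qed.

Lemma tail_correct (B : R) (f : R -> R) (y : R) :
  Y3_bounded B f -> is_lim_seq (fun n => RInt f y (INR n)) (tail f y).
Proof.
  intros Hf; apply Lim_seq_correct'.
  exists (RInt f y 0 + tail f 0).
  apply is_lim_seq_ext with (fun n => RInt f y 0 + RInt f 0 (INR n)).
  { intros n; symmetry; apply RInt_split_at, Hf. }
  apply is_lim_seq_plus'; [apply is_lim_seq_const|now apply tail_0_correct with B].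
Qed.

Lemma tail_split (B : R) (f : R -> R) (x y : R) :
  Y3_bounded B f -> tail f x = RInt f x y + tail f y.
Proof.
  intros Hf; unfold tail at 1.
  rewrite (Lim_seq_ext _ (fun n => RInt f x y + RInt f y (INR n)))
    by (intros n; apply RInt_split_at, Hf).
  apply (f_equal real (y := Finite (RInt f x y + tail f y))), is_lim_seq_unique.
  apply is_lim_seq_plus'; [apply is_lim_seq_const|now apply tail_correct with B].
Qed.

Lemma tail_bound (B : R) (f : R -> R) (y : R) :
  Y3_bounded B f -> 0 <= y -> Rabs (tail f y) <= B * Y y ^ 3.
Proof.
  intros Hf Hy; assert (HB := Y3_bounded_ge0 _ _ Hf).
  (* The integer bounds of integration beyond [y] are those from [S N] on. *)
  destruct (nfloor_ex y Hy) as [N HN].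
  assert (Hb : forall n, Rabs (RInt f y (INR (n + S N))) <= B * Y y ^ 3).
  { intros n; eapply Rle_trans.
    - apply abs_RInt_Y3_bounded; [exact Hf|].
      rewrite plus_INR, S_INR; generalize (pos_INR n); lra.
    - apply Rmult_le_compat_l; [exact HB|now apply Y3_primitive_tail]. }
  assert (Hl := proj1 (is_lim_seq_incr_n _ (S N) _) (tail_correct B f y Hf)).
  apply is_lim_seq_abs in Hl.
  exact (is_lim_seq_le _ _ _ _ Hb Hl (is_lim_seq_const _)).
Qed.

Lemma tail_minus (B B' : R) (f g : R -> R) (y : R) :
  Y3_bounded B f -> Y3_bounded B' g ->
  tail (fun z => f z - g z) y = tail f y - tail g y.
Proof.
  intros Hf Hg; unfold tail at 1.
  rewrite (Lim_seq_ext _ (fun n => RInt f y (INR n) - RInt g y (INR n))).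
  - apply (f_equal real (y := Finite (tail f y - tail g y))), is_lim_seq_unique.
    apply is_lim_seq_minus'; [now apply tail_correct with B|now apply tail_correct with B'].
  - intros n; apply (RInt_minus f g); apply ex_RInt_cont; [apply Hf|apply Hg].
Qed.

Lemma is_derive_RInt_cont (f : R -> R) (a y : R) :
  (forall z, continuous f z) -> is_derive (fun x => RInt f a x) y (f y).
Proof.
  intros Hf; apply (is_derive_RInt f (fun x => RInt f a x) a y); auto.
  apply filter_forall; intros x; now apply (RInt_correct f), ex_RInt_cont.
Qed.

Lemma is_derive_tail (B : R) (f : R -> R) (y : R) :
  Y3_bounded B f -> is_derive (tail f) y (- f y).
Proof.
  intros Hf.
  apply is_derive_ext with (fun x => tail f 0 - RInt f 0 x).
  { intros x; rewrite (tail_split B f 0 x Hf); apply Rplus_minus_l. }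
  replace (- f y) with (0 - f y) by ring.
  apply (is_derive_minus (fun _ => tail f 0) (fun x => RInt f 0 x));
    [apply (is_derive_const (tail f 0))|apply is_derive_RInt_cont, Hf].
Qed.

(** The integral of an odd function over the interval from [- |y|] to [|y|]
    vanishes. *)
Lemma tail_abs_of_odd (B : R) (f : R -> R) (y : R) :
  Y3_bounded B f -> odd_fun f -> tail f (Rabs y) = tail f y.
Proof.
  intros Hf Hodd; unfold Rabs; destruct (Rcase_abs y); [|reflexivity].
  assert (Hz : forall a, RInt f (- a) (- 0) = RInt f a 0).
  { intros a; rewrite RInt_reflect by apply Hf.
    rewrite (RInt_ext (fun z => f (- z)) (fun z => opp (f z)))
      by (intros z _; apply Hodd).
    rewrite (RInt_opp f) by apply ex_RInt_cont, Hf; apply Ropp_involutive. }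
  rewrite Ropp_0 in Hz.
  now rewrite (tail_split B f (- y) 0 Hf), (tail_split B f y 0 Hf), Hz.
Qed.

(** * The amplitude of the perturbation *)

(** The factor v in K = H + Y v, recovered from p = v' / Y. *)
Definition amplitude (p : R -> R) (y : R) : R := RInt (fun s => Y s * p s) 0 y.

Lemma continuous_Y_mult (p : R -> R) :
  (forall y, continuous p y) -> forall y, continuous (fun s => Y s * p s) y.
Proof. intros Hp y; apply (continuous_mult Y p); auto using continuous_Y. Qed.

Lemma is_derive_amplitude (p : R -> R) (y : R) :
  (forall z, continuous p z) -> is_derive (amplitude p) y (Y y * p y).
Proof.
  intros Hp; apply (is_derive_RInt_cont (fun s => Y s * p s)).
  now apply continuous_Y_mult.
Qed.

Lemma continuous_amplitude (p : R -> R) (y : R) :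
  (forall z, continuous p z) -> continuous (amplitude p) y.
Proof.
  intros Hp; apply (ex_derive_continuous (amplitude p)).
  eexists; now apply is_derive_amplitude.
Qed.

Lemma amplitude_odd (p : R -> R) :
  (forall y, continuous p y) -> (forall y, p (- y) = p y) ->
  odd_fun (amplitude p).
Proof.
  intros Hp He y; unfold amplitude.
  rewrite <- Ropp_0 at 1.
  rewrite (RInt_reflect (fun s => Y s * p s)) by now apply continuous_Y_mult.
  f_equal; apply RInt_ext; intros z _; now rewrite Y_even, He.
Qed.

(** The total variation of the primitive r H of Y is finite, which is why a bounded
    [p] gives a bounded amplitude. *)
Lemma abs_amplitude_le (p : R -> R) (D : R) :
  (forall y, continuous p y) -> (forall y, Rabs (p y) <= D) ->
  forall y, Rabs (amplitude p y) <= sqrt 2 * D.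
Proof.
  intros Hp HD y.
  assert (HD0 : 0 <= D) by (generalize (HD 0) (Rabs_pos (p 0)); lra).
  assert (Hi : forall a b, a <= b ->
    Rabs (RInt (fun s => Y s * p s) a b) <= sqrt 2 * D * (H b - H a)).
  { intros a b Hab; rewrite Rmult_minus_distr_l.
    apply (abs_RInt_le_primitive (fun s => Y s * p s)
             (fun s => sqrt 2 * D * H s) (fun s => D * Y s)); auto.
    - now apply continuous_Y_mult.
    - intros z; apply (continuous_mult (fun _ => D) Y);
        [apply continuous_const|apply continuous_Y].
    - intros z.
      replace (D * Y z) with (sqrt 2 * D * (sqrt 2 / 2 * Y z)).
      + apply (is_derive_scal H z (sqrt 2 * D) (sqrt 2 / 2 * Y z)), is_derive_H.
      + transitivity (sqrt 2 * sqrt 2 / 2 * D * Y z);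
          [|rewrite sqrt2_sqr]; field.
    - intros z _; rewrite Rabs_mult, Rabs_pos_eq by (left; apply Y_pos).
      rewrite Rmult_comm; apply Rmult_le_compat_r; [left; apply Y_pos|apply HD]. }
  assert (H0 : H 0 = 0) by (generalize (H_odd 0); rewrite Ropp_0; lra).
  assert (Hr : 0 <= sqrt 2 * D)
    by (apply Rmult_le_pos; [apply sqrt_pos|exact HD0]).
  assert (Hb := H_bounds y); unfold amplitude.
  assert (Hs : sqrt 2 * D * (H y - 0) <= sqrt 2 * D * 1 /\
               sqrt 2 * D * (0 - H y) <= sqrt 2 * D * 1)
    by (split; apply Rmult_le_compat_l; lra).
  destruct (Rle_dec 0 y) as [Hy|Hy].
  - generalize (Hi 0 y Hy); rewrite H0; lra.
  - rewrite <- (opp_RInt_swap (fun s => Y s * p s))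
      by (apply ex_RInt_cont; now apply continuous_Y_mult).
    generalize (Hi y 0 ltac:(lra)); rewrite H0.
    unfold opp; simpl; rewrite Rabs_Ropp; lra.
Qed.

Lemma amplitude_minus (p q : R -> R) (y : R) :
  (forall z, continuous p z) -> (forall z, continuous q z) ->
  amplitude p y - amplitude q y = amplitude (fun z => p z - q z) y.
Proof.
  intros Hp Hq; unfold amplitude.
  rewrite (RInt_ext (fun s => Y s * (p s - q s))
             (fun s => minus (Y s * p s) (Y s * q s)))
    by (intros z _; apply Rmult_minus_distr_l).
  symmetry; apply (RInt_minus (fun s => Y s * p s) (fun s => Y s * q s));
    apply ex_RInt_cont; now apply continuous_Y_mult.
Qed.

(** * Pointwise estimates of the nonlinearity *)
Lemma Rabs_mult_le (x y a b : R) :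
  Rabs x <= a -> Rabs y <= b -> Rabs (x * y) <= a * b.
Proof.
  intros; rewrite Rabs_mult; apply Rmult_le_compat; auto using Rabs_pos.
Qed.

(** The expression N, with [beta], [h], [s], [v], [p] standing for the values of
    b / Y, H, Y, v and p at a point. *)
Definition forcing (beta h s v p : R) : R :=
  sqrt 2 / 2 * beta - sqrt 2 * beta * h * v + beta * s * p
  + 3 * h * v ^ 2 + s * v ^ 3.

Lemma forcing_bound (eps beta h s v p : R) :
  0 <= eps <= / 100 -> Rabs beta <= eps -> Rabs h <= 1 -> Rabs s <= 1 ->
  Rabs v <= sqrt 2 * (2 * eps) -> Rabs p <= 2 * eps ->
  Rabs (forcing beta h s v p) <= 2 * eps.
Proof.
  intros He Hbeta Hh Hs Hv Hp; unfold forcing.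
  assert (Hr := sqrt2_bounds).
  assert (Hv3 : Rabs v <= 3 * eps) by (eapply Rle_trans; [exact Hv|nra]).
  assert (Hrabs : Rabs (sqrt 2) <= 3 / 2) by (rewrite Rabs_pos_eq; lra).
  assert (H1 := Rabs_mult_le _ _ _ _ Hrabs Hbeta).
  assert (H2 := Rabs_mult_le _ _ _ _ (Rabs_mult_le _ _ _ _ H1 Hh) Hv3).
  assert (H3 := Rabs_mult_le _ _ _ _ (Rabs_mult_le _ _ _ _ Hbeta Hs) Hp).
  assert (Hvv := Rabs_mult_le _ _ _ _ Hv3 Hv3).
  assert (H4 := Rabs_mult_le _ _ _ _ Hh Hvv).
  assert (H5 := Rabs_mult_le _ _ _ _ Hs (Rabs_mult_le _ _ _ _ Hv3 Hvv)).
  rewrite Rabs_le_between in H1, H2, H3, H4, H5.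
  assert (eps * eps <= / 100 * eps) by nra.
  assert (eps * eps * eps <= / 100 * eps) by nra.
  apply Rabs_le_between; simpl; lra.
Qed.

Lemma forcing_lipschitz (eps D beta h s v w p q : R) :
  0 <= eps <= / 100 -> 0 <= D -> Rabs beta <= eps -> Rabs h <= 1 ->
  Rabs s <= 1 ->
  Rabs v <= sqrt 2 * (2 * eps) -> Rabs w <= sqrt 2 * (2 * eps) ->
  Rabs (v - w) <= sqrt 2 * D -> Rabs (p - q) <= D ->
  Rabs (forcing beta h s v p - forcing beta h s w q) <= D / 2.
Proof.
  intros He HD Hbeta Hh Hs Hv Hw Hvw Hpq.
  assert (Hr := sqrt2_bounds).
  assert (Hv3 : Rabs v <= 3 * eps) by (eapply Rle_trans; [exact Hv|nra]).
  assert (Hw3 : Rabs w <= 3 * eps) by (eapply Rle_trans; [exact Hw|nra]).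
  assert (Hvw2 : Rabs (v - w) <= 3 / 2 * D) by (eapply Rle_trans; [exact Hvw|nra]).
  assert (Hrabs : Rabs (sqrt 2) <= 3 / 2) by (rewrite Rabs_pos_eq; lra).
  (* Every term of the difference carries a factor v - w or p - q. *)
  replace (forcing beta h s v p - forcing beta h s w q) with
    (- (sqrt 2 * beta * h * (v - w)) + beta * s * (p - q)
     + 3 * (h * (v + w) * (v - w))
     + s * (v * v + v * w + w * w) * (v - w)) by (unfold forcing; ring).
  assert (H1 := Rabs_mult_le _ _ _ _ (Rabs_mult_le _ _ _ _
                  (Rabs_mult_le _ _ _ _ Hrabs Hbeta) Hh) Hvw2).
  assert (H2 := Rabs_mult_le _ _ _ _ (Rabs_mult_le _ _ _ _ Hbeta Hs) Hpq).
  assert (Hsum : Rabs (v + w) <= 6 * eps)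
    by (eapply Rle_trans; [apply Rabs_triang|lra]).
  assert (H3 := Rabs_mult_le _ _ _ _ (Rabs_mult_le _ _ _ _ Hh Hsum) Hvw2).
  assert (Hquad : Rabs (v * v + v * w + w * w) <= 27 * (eps * eps)).
  { generalize (Rabs_mult_le _ _ _ _ Hv3 Hv3) (Rabs_mult_le _ _ _ _ Hv3 Hw3)
      (Rabs_mult_le _ _ _ _ Hw3 Hw3); rewrite !Rabs_le_between; lra. }
  assert (H4 := Rabs_mult_le _ _ _ _ (Rabs_mult_le _ _ _ _ Hs Hquad) Hvw2).
  rewrite Rabs_le_between in H1, H2, H3, H4.
  assert (0 <= eps * D <= / 100 * D) by nra.
  assert (eps * (eps * D) <= / 100 * (eps * D)) by (apply Rmult_le_compat_r; lra).
  apply Rabs_le_between; lra.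
Qed.

(** * The fixed point equation *)
Section Perturbation.

Variables (b : R -> R) (eps : R).
Hypothesis eps_small : 0 <= eps <= / 100.
Hypothesis b_continuous : forall y, continuous b y.
Hypothesis b_bound : forall y, Rabs (b y) <= eps * Y y.

(** The right-hand side Y^3 N of the equation for w. *)
Definition source (p : R -> R) (y : R) : R :=
  Y y ^ 3 * forcing (b y / Y y) (H y) (Y y) (amplitude p y) (p y).

(** The map whose fixed points p solve the system; p is w / Y^3, the slope of the
    amplitude being Y p. *)
Definition slope_map (p : R -> R) (y : R) : R :=
  - tail (source p) (Rabs y) / Y y ^ 3.

Lemma abs_ratio_le (y : R) : Rabs (b y / Y y) <= eps.
Proof.
  assert (HY := Y_pos y).
  unfold Rdiv; rewrite Rabs_mult, (Rabs_pos_eq (/ Y y))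
    by (left; now apply Rinv_0_lt_compat).
  apply (Rmult_le_reg_r (Y y)); auto.
  rewrite Rmult_assoc, Rinv_l, Rmult_1_r by lra; apply b_bound.
Qed.

Lemma abs_H_le_1 (y : R) : Rabs (H y) <= 1.
Proof. generalize (H_bounds y); rewrite Rabs_le_between; lra. Qed.

Lemma abs_Y_le_1 (y : R) : Rabs (Y y) <= 1.
Proof. generalize (Y_pos y) (Y_le_1 y); rewrite Rabs_le_between; lra. Qed.

Lemma continuous_source (p : R -> R) (y : R) :
  (forall z, continuous p z) -> continuous (source p) y.
Proof.
  intros Hp.
  assert (Hv := continuous_amplitude p y Hp).
  assert (HY := continuous_Y y); assert (Hh := continuous_H y).
  assert (Hc : forall c : R, continuous (fun _ : R => c) y)
    by (intros; apply continuous_const).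
  assert (Hmul : forall f g : R -> R, continuous f y -> continuous g y ->
    continuous (fun z => f z * g z) y)
    by (intros f g; apply (continuous_mult f g)).
  assert (Hadd : forall f g : R -> R, continuous f y -> continuous g y ->
    continuous (fun z => f z + g z) y)
    by (intros f g; apply (continuous_plus f g)).
  assert (Hsub : forall f g : R -> R, continuous f y -> continuous g y ->
    continuous (fun z => f z - g z) y)
    by (intros f g; apply (continuous_minus f g)).
  assert (Hbeta : continuous (fun z => b z / Y z) y).
  { apply Hmul; [apply b_continuous|].
    apply continuous_Rinv_comp; [exact HY|apply Rgt_not_eq, Y_pos]. }
  unfold source, forcing.
  repeat match goal with
    | |- continuous (fun z : R => b z / Y z) y => exact Hbeta
    | |- continuous (fun z : R => amplitude p z) y => exact Hv
    | |- continuous (fun z : R => H z) y => exact Hh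
    | |- continuous (fun z : R => Y z) y => exact HY
    | |- continuous (fun z : R => p z) y => apply Hp
    | |- continuous (fun _ : R => ?c) y => apply (Hc c)
    | |- continuous (fun z : R => @?f z ^ _) y => apply (continuous_pow_comp f)
    | |- continuous (fun z : R => @?f z * @?g z) y => apply (Hmul f g)
    | |- continuous (fun z : R => @?f z + @?g z) y => apply (Hadd f g)
    | |- continuous (fun z : R => @?f z - @?g z) y => apply (Hsub f g)
    end.
Qed.

Lemma source_Y3_bounded (p : R -> R) :
  admissible (2 * eps) p -> Y3_bounded (2 * eps) (source p).
Proof.
  intros [Hc Hp]; split; intros y; [now apply continuous_source|].
  assert (HY := pow_lt _ 3 (Y_pos y)).
  unfold source; rewrite Rabs_mult, (Rabs_pos_eq (Y y ^ 3)) by lra.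
  rewrite Rmult_comm; apply Rmult_le_compat_r; [lra|].
  apply forcing_bound;
    auto using abs_ratio_le, abs_H_le_1, abs_Y_le_1, abs_amplitude_le.
Qed.

Lemma abs_div_Y3_le (x B y : R) :
  Rabs x <= B * Y y ^ 3 -> Rabs (x / Y y ^ 3) <= B.
Proof.
  intros Hx; assert (HY := pow_lt _ 3 (Y_pos y)).
  unfold Rdiv; rewrite Rabs_mult, (Rabs_pos_eq (/ _))
    by (left; now apply Rinv_0_lt_compat).
  apply (Rmult_le_reg_r (Y y ^ 3)); auto.
  rewrite Rmult_assoc, Rinv_l, Rmult_1_r by lra; exact Hx.
Qed.

Lemma slope_map_admissible (p : R -> R) :
  admissible (2 * eps) p -> admissible (2 * eps) (slope_map p).
Proof.
  intros Hp; assert (HS := source_Y3_bounded p Hp); split; intros y.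
  - apply (continuous_mult (fun z => - tail (source p) (Rabs z))
             (fun z => / Y z ^ 3)).
    + apply (continuous_opp (fun z => tail (source p) (Rabs z))).
      apply (continuous_comp Rabs (tail (source p))).
      * apply (continuous_Rabs_comp (fun z => z)), continuous_id.
      * apply (ex_derive_continuous (tail (source p))).
        eexists; now apply is_derive_tail with (2 * eps).
    + apply continuous_Rinv_comp.
      * apply continuous_pow_comp, continuous_Y.
      * apply Rgt_not_eq, pow_lt, Y_pos.
  - apply abs_div_Y3_le; rewrite Rabs_Ropp, <- (Y_abs y).
    apply tail_bound; auto using Rabs_pos.
Qed.

Lemma slope_map_contracts (p q : R -> R) (D : R) :
  admissible (2 * eps) p -> admissible (2 * eps) q ->
  (forall y, Rabs (p y - q y) <= D) ->
  forall y, Rabs (slope_map p y - slope_map q y) <= D / 2.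
Proof.
  intros Hp Hq HD y.
  assert (HD0 : 0 <= D) by (generalize (HD 0) (Rabs_pos (p 0 - q 0)); lra).
  assert (HSp := source_Y3_bounded p Hp).
  assert (HSq := source_Y3_bounded q Hq).
  unfold slope_map.
  replace (- tail (source p) (Rabs y) / Y y ^ 3 - - tail (source q) (Rabs y) / Y y ^ 3)
    with (- tail (fun z => source p z - source q z) (Rabs y) / Y y ^ 3)
    by (rewrite (tail_minus (2 * eps) (2 * eps)) by assumption;
        field; apply Rgt_not_eq, Y_pos).
  apply abs_div_Y3_le; rewrite Rabs_Ropp, <- (Y_abs y).
  apply tail_bound; [|apply Rabs_pos].
  split; intros z.
  - apply (continuous_minus (source p) (source q)); [apply HSp|apply HSq].
  - assert (HY := pow_lt _ 3 (Y_pos z)).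
    unfold source; rewrite <- Rmult_minus_distr_l.
    rewrite Rabs_mult, (Rabs_pos_eq (Y z ^ 3)) by lra.
    rewrite Rmult_comm; apply Rmult_le_compat_r; [lra|].
    destruct Hp as [Hpc Hp]; destruct Hq as [Hqc Hq].
    apply forcing_lipschitz with eps;
      auto using abs_ratio_le, abs_H_le_1, abs_Y_le_1, abs_amplitude_le.
    rewrite amplitude_minus by assumption.
    apply abs_amplitude_le; auto.
    intros x; now apply (continuous_minus p q).
Qed.

Lemma slope_map_even (p : R -> R) (y : R) : slope_map p (- y) = slope_map p y.
Proof. unfold slope_map; now rewrite Rabs_Ropp, Y_even. Qed.

Lemma source_odd (p : R -> R) :
  odd_fun b -> (forall y, continuous p y) -> (forall y, p (- y) = p y) ->
  odd_fun (source p).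
Proof.
  intros Hb Hc Hp y; unfold source, forcing.
  rewrite Hb, H_odd, Y_even, Hp, (amplitude_odd p Hc Hp y).
  field; apply Rgt_not_eq, Y_pos.
Qed.

(** A small solution of the system: p is even and w = Y^3 p satisfies w' = Y^3 N. *)
Lemma exists_slope :
  odd_fun b ->
  exists p w : R -> R,
    admissible (2 * eps) p /\ (forall y, p (- y) = p y) /\
    (forall y, w y = Y y ^ 3 * p y) /\
    (forall y, is_derive w y (source p y)).
Proof.
  intros Hb.
  destruct (contraction_fixed_point (2 * eps) slope_map) as [p [Hp Hfix]];
    [lra|exact slope_map_admissible|exact slope_map_contracts|].
  assert (He : forall y, p (- y) = p y)
    by (intros y; rewrite <- !Hfix; apply slope_map_even).
  assert (HS := source_Y3_bounded p Hp).
  exists p, (fun y => - tail (source p) y).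
  split; [exact Hp|split; [exact He|split]].
  - intros y; rewrite <- (Hfix y); unfold slope_map.
    rewrite (tail_abs_of_odd (2 * eps)) by (auto; apply source_odd; auto; apply Hp).
    field; apply Rgt_not_eq, Y_pos.
  - intros y; rewrite <- (Ropp_involutive (source p y)).
    apply (is_derive_opp (tail (source p))), is_derive_tail with (2 * eps), HS.
Qed.

End Perturbation.

(** * The perturbed kink *)
Lemma is_derive_Derive_n_2 (f f1 f2 : R -> R) :
  (forall y, is_derive f y (f1 y)) -> (forall y, is_derive f1 y (f2 y)) ->
  twice_differentiable f /\ (forall y, Derive f y = f1 y) /\
  (forall y, Derive_n f 2 y = f2 y).
Proof.
  intros H1 H2.
  assert (Hd : forall y, Derive f y = f1 y)
    by (intros y; now apply is_derive_unique).
  assert (Hd2 : forall y, is_derive (Derive f) y (f2 y)).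
  { intros y; apply is_derive_ext with f1; auto. }
  split; [|split; [exact Hd|]].
  - intros x; split; [now exists (f1 x)|now exists (f2 x)].
  - intros y; now apply (is_derive_unique (Derive f)).
Qed.

Lemma is_derive_Y_mult (v : R -> R) (y l : R) :
  is_derive v y l ->
  is_derive (fun z => Y z * v z) y (- sqrt 2 * H y * Y y * v y + Y y * l).
Proof.
  intros Hv; apply (is_derive_mult Y v); auto using is_derive_Y.
  exact Rmult_comm.
Qed.

(** The function differentiated here is K', written with w / Y in place of Y^2 p,
    since w is known to be differentiable and p is not. *)
Lemma is_derive_profile_slope (v w : R -> R) (y p s : R) :
  is_derive v y (Y y * p) -> is_derive w y s -> w y = Y y ^ 3 * p ->
  is_derive (fun z => sqrt 2 / 2 * Y z - sqrt 2 * H z * (Y z * v z) + w z / Y z) y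
    (- H y * Y y + (3 * H y ^ 2 - 1) * (Y y * v y) + s / Y y).
Proof.
  intros Hv Hw Hwy.
  assert (HH := is_derive_H y); assert (HY := is_derive_Y y).
  assert (HY0 := Rgt_not_eq _ _ (Y_pos y)).
  auto_derive.
  - repeat split; auto; eexists; eassumption.
  - replace (Derive (fun z => H z) y) with (sqrt 2 / 2 * Y y)
      by (symmetry; now apply is_derive_unique).
    replace (Derive (fun z => Y z) y) with (- sqrt 2 * H y * Y y)
      by (symmetry; now apply is_derive_unique).
    replace (Derive (fun z => v z) y) with (Y y * p)
      by (symmetry; now apply is_derive_unique).
    replace (Derive (fun z => w z) y) with s
      by (symmetry; now apply is_derive_unique).
    rewrite Hwy.
    transitivity (sqrt 2 * sqrt 2 / 2 * (- H y * Y y - Y y * (Y y * v y)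
       + 2 * H y ^ 2 * (Y y * v y)) + s / Y y); [field; auto|].
    rewrite sqrt2_sqr; unfold Y; field; exact HY0.
Qed.

Theorem theorem1p1 :
  forall C : R, 0 < C ->
  exists delta0 C' : R, 0 < delta0 /\ 0 < C' /\
  forall (delta : R) (b : R -> R),
    0 < delta < delta0 ->
    odd_fun b ->
    (forall y, ex_derive b y) ->
    (forall y, Rabs (b y) <= C * (delta * exp (- sqrt 2 * Rabs y))) ->
    (forall y, Rabs (Derive b y) <= C * delta) ->
    exists K : R -> R,
      odd_fun K /\ bounded_fun K /\
      solves_wave b (fun _ y => K y) /\
      (forall y, - Derive_n K 2 y + b y * Derive K y = K y - K y ^ 3) /\
      (forall y,
         Rabs (K y - H y) + Rabs (Derive (fun x => K x - H x) y)
         <= C' * (delta * exp (- sqrt 2 * Rabs y))).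
Proof.
  intros C HC.
  (* With eps = C delta below, |K - H| is at most 3 eps Y and its derivative at
     most (13/2) eps Y; the bound 10 eps Y and Y <= 4 exp (- r |y|) give 40 C. *)
  exists (/ (100 * C)), (40 * C).
  assert (H100 : 0 < / (100 * C)) by (apply Rinv_0_lt_compat; lra).
  do 2 (split; [lra|]).
  intros delta b Hdelta Hodd Hdiff Hb _.
  set (eps := C * delta).
  assert (Heps : 0 <= eps <= / 100).
  { unfold eps; split; [apply Rmult_le_pos; lra|].
    replace (/ 100) with (C * / (100 * C)) by (field; lra).
    apply Rmult_le_compat_l; lra. }
  assert (HbY : forall y, Rabs (b y) <= eps * Y y).
  { intros y; eapply Rle_trans; [apply Hb|].
    rewrite <- Rmult_assoc; apply Rmult_le_compat_l; [apply Heps|].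
    apply Y_exp_bounds. }
  assert (Hbc : forall y, continuous b y)
    by (intros y; apply (ex_derive_continuous b), Hdiff).
  destruct (exists_slope b eps Heps Hbc HbY Hodd) as (p & w & [Hpc Hp] & Heven & Hw & Hdw).
  set (v := amplitude p).
  assert (Hdv : forall y, is_derive v y (Y y * p y))
    by (intros y; now apply is_derive_amplitude).
  assert (Hv := abs_amplitude_le p _ Hpc Hp : forall y, Rabs (v y) <= _).
  set (K := fun y => H y + Y y * v y).
  set (K1 := fun y => sqrt 2 / 2 * Y y - sqrt 2 * H y * (Y y * v y) + w y / Y y).
  set (K2 := fun y => - H y * Y y + (3 * H y ^ 2 - 1) * (Y y * v y)
                      + source b p y / Y y).
  assert (Hdu : forall y, is_derive (fun z => Y z * v z) y
            (- sqrt 2 * H y * Y y * v y + Y y * (Y y * p y)))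
    by (intros y; now apply is_derive_Y_mult).
  assert (HK1 : forall y, is_derive K y (K1 y)).
  { intros y.
    replace (K1 y) with (sqrt 2 / 2 * Y y
        + (- sqrt 2 * H y * Y y * v y + Y y * (Y y * p y)))
      by (unfold K1; rewrite Hw; field; apply Rgt_not_eq, Y_pos).
    apply (is_derive_plus H (fun z => Y z * v z)); auto using is_derive_H. }
  assert (HK2 : forall y, is_derive K1 y (K2 y))
    by (intros y; now apply is_derive_profile_slope with (p y)).
  destruct (is_derive_Derive_n_2 K K1 K2 HK1 HK2) as (Htw & HDK & HD2K).
  assert (Hode : forall y, - Derive_n K 2 y + b y * Derive K y = K y - K y ^ 3).
  { intros y; rewrite HDK, HD2K; unfold K, K1, K2; rewrite Hw.
    assert (HY := Rgt_not_eq _ _ (Y_pos y)).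
    unfold source, forcing; fold v.
    (* The middle expression is K - K^3 expanded in powers of Y v, with
       H - H^3 = H Y. *)
    transitivity (H y * Y y + (1 - 3 * H y ^ 2) * (Y y * v y)
                  - 3 * H y * (Y y * v y) ^ 2 - (Y y * v y) ^ 3);
      [field; exact HY|unfold Y; ring]. }
  exists K; split; [|split; [|split; [|split; [exact Hode|]]]].
  - intros y; unfold K, v; rewrite H_odd, Y_even, amplitude_odd by assumption.
    ring.
  - exists (1 + sqrt 2 * (2 * eps)); intros y; unfold K.
    eapply Rle_trans; [apply Rabs_triang|].
    generalize (abs_H_le_1 y)
      (Rabs_mult_le _ _ _ _ (abs_Y_le_1 y) (Hv y)); lra.
  - split; [|split; [intros _; exact Htw|]].
    + intros y t; split; [apply ex_derive_const|].
      apply (ex_derive_ext (fun _ => 0)); [|apply ex_derive_const].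
      intros s; now rewrite Derive_const.
    + intros t y; rewrite <- Hode, Derive_n_const, Rminus_0_l; reflexivity.
  - intros y.
    assert (Hu : Derive (fun x => K x - H x) y
             = - sqrt 2 * H y * Y y * v y + Y y * (Y y * p y)).
    { apply is_derive_unique.
      apply is_derive_ext with (fun z => Y z * v z); [|apply Hdu].
      intros z; unfold K; now rewrite Rplus_minus_l. }
    rewrite Hu; unfold K; rewrite Rplus_minus_l.
    replace (- sqrt 2 * H y * Y y * v y + Y y * (Y y * p y))
      with (Y y * (- (sqrt 2 * (H y * v y)) + Y y * p y)) by ring.
    assert (HY := Y_pos y); assert (HYe := proj2 (Y_exp_bounds y)).
    assert (Hr := sqrt2_bounds).
    assert (Hrabs : Rabs (sqrt 2) <= 3 / 2) by (rewrite Rabs_pos_eq; lra).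
    assert (Hv3 : Rabs (v y) <= 3 * eps) by (eapply Rle_trans; [apply Hv|nra]).
    assert (H1 := Rabs_mult_le _ _ _ _ Hrabs
                   (Rabs_mult_le _ _ _ _ (abs_H_le_1 y) Hv3)).
    assert (H2 := Rabs_mult_le _ _ _ _ (abs_Y_le_1 y) (Hp y)).
    assert (H3 : Rabs (- (sqrt 2 * (H y * v y)) + Y y * p y) <= 13 / 2 * eps)
      by (revert H1 H2; rewrite !Rabs_le_between; lra).
    rewrite !Rabs_mult, (Rabs_pos_eq (Y y)) by lra.
    apply Rle_trans with (10 * eps * Y y); [nra|].
    replace (40 * C * (delta * exp (- sqrt 2 * Rabs y)))
      with (10 * eps * (4 * exp (- sqrt 2 * Rabs y))) by (unfold eps; ring).
    apply Rmult_le_compat_l; lra.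
Qed.
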